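(* Let $G$ be a connected graph with $n$ vertices and $m\geq 1$ edges. Then $$S_Q(\mathcal{T}(G))\geq 2\sqrt{\left(\frac{3m}{n}-\frac{Z_g(G)}{m}\right)^2+\frac{10m}{n}-\frac{2Z_g(G)}{m}+1}.$$
   Context: Graphs are finite, simple and undirected. $Z_g(G)=\sum_{i\in V(G)}d(i)^2$ is the (first) Zagreb index, $d(i)$ being the degree of vertex $i$. The line graph $\mathcal{L}(G)$ has the edges of $G$ as vertices, two being adjacent if the corresponding edges share a vertex. The total graph $\mathcal{T}(G)$ has vertex set $V(G)\cup E(G)$; two vertices of $\mathcal{T}(G)$ are adjacent if the corresponding elements are two adjacent vertices of $G$, or two edges of $G$ adjacent in $\mathcal{L}(G)$, or a vertex and an edge of $G$ incident with each other. For a graph $H$, $S_Q(H)$ is the signless Laplacian spread: the largest minus the smallest eigenvalue of $Q(H)=D(H)+A(H)$, where $A(H)$ is the adjacency matrix and $D(H)$ the diagonal matrix of vertex degrees. *)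

(* Defs.v *)
From HB Require Import structures.
From mathcomp Require Import all_boot all_order all_algebra.
From mathcomp Require Import all_classical all_reals.

Set Implicit Arguments.
Unset Strict Implicit.
Unset Printing Implicit Defensive.
Import Order.TTheory GRing.Theory Num.Theory.
Local Open Scope ring_scope.

Record sgraph := SGraph {
  vertex :> finType;
  adj : rel vertex;
  adj_sym : symmetric adj;
  adj_irr : irreflexive adj
}.

Definition connected_graph (G : sgraph) : Prop :=
  forall x y : G, connect (@adj G) x y.

Definition degree (G : sgraph) (x : G) : nat := #|[set y | adj x y]|.

Definition zagreb (G : sgraph) : nat := (\sum_(x : G) degree x ^ 2)%N.

(* An edge is the two-element set of its endpoints. *)
Definition edges (G : sgraph) : {set {set G}} :=
  [set [set p.1; p.2] | p : G * G & adj p.1 p.2].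

Definition edge (G : sgraph) : finType := {a : {set G} | a \in edges G}.

Definition line_adj (G : sgraph) (a b : edge G) : bool :=
  (a != b) && (val a :&: val b != finset.set0).

Lemma line_adj_sym (G : sgraph) : symmetric (@line_adj G).
Proof. by move=> a b; rewrite /line_adj eq_sym finset.setIC. Qed.

Lemma line_adj_irr (G : sgraph) : irreflexive (@line_adj G).
Proof. by move=> a; rewrite /line_adj eqxx. Qed.

Definition line_graph (G : sgraph) : sgraph :=
  SGraph (@line_adj_sym G) (@line_adj_irr G).

Definition total_adj (G : sgraph) (u v : G + edge G) : bool :=
  match u, v with
  | inl x, inl y => adj x y
  | inr a, inr b => @adj (line_graph G) a b
  | inl x, inr a | inr a, inl x => x \in val a
  end.

Lemma total_adj_sym (G : sgraph) : symmetric (@total_adj G).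
Proof. by move=> [x|a] [y|b] //=; [exact: adj_sym | exact: line_adj_sym]. Qed.

Lemma total_adj_irr (G : sgraph) : irreflexive (@total_adj G).
Proof. by move=> [x|a] /=; [exact: adj_irr | exact: line_adj_irr]. Qed.

Definition total_graph (G : sgraph) : sgraph :=
  SGraph (@total_adj_sym G) (@total_adj_irr G).

Definition adjacency_mx (R : realType) (G : sgraph) : 'M[R]_#|G| :=
  \matrix_(i, j) (adj (enum_val i) (enum_val j))%:R.

Definition degree_mx (R : realType) (G : sgraph) : 'M[R]_#|G| :=
  diag_mx (\row_i (degree (enum_val i))%:R).

Definition signless_laplacian (R : realType) (G : sgraph) : 'M[R]_#|G| :=
  degree_mx R G + adjacency_mx R G.

(* The set of eigenvalues is finite, and nonempty for a real symmetric matrix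
   of positive size, so there sup and inf are a maximum and a minimum. *)
Definition largest_eigenvalue (R : realType) (n : nat) (M : 'M[R]_n) : R :=
  sup [set a : R | eigenvalue M a]%classic.

Definition smallest_eigenvalue (R : realType) (n : nat) (M : 'M[R]_n) : R :=
  inf [set a : R | eigenvalue M a]%classic.

Lemma largest_eigenvalueE (R : realType) (n : nat) (M : 'M[R]_n) (a : R) :
  eigenvalue M a -> (forall b, eigenvalue M b -> b <= a) ->
  largest_eigenvalue M = a.
Proof.
move=> Ma Mle; apply/eqP; rewrite eq_le; apply/andP; split.
- by apply: ge_sup; [exists a | move=> b /Mle].
- by apply: ub_le_sup => //; exists a => b /Mle.
Qed.

Lemma smallest_eigenvalueE (R : realType) (n : nat) (M : 'M[R]_n) (a : R) :
  eigenvalue M a -> (forall b, eigenvalue M b -> a <= b) ->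
  smallest_eigenvalue M = a.
Proof.
move=> Ma Mge; apply/eqP; rewrite eq_le; apply/andP; split.
- by apply: ge_inf => //; exists a => b /Mge.
- by apply: lb_le_inf; [exists a | move=> b /Mge].
Qed.

Definition signless_spread (R : realType) (G : sgraph) : R :=
  largest_eigenvalue (signless_laplacian R G)
  - smallest_eigenvalue (signless_laplacian R G).

(* Main.v *)
Require Import Defs.
From HB Require Import structures.
From mathcomp Require Import all_boot all_order all_algebra.
From mathcomp Require Import all_classical all_reals.
From mathcomp Require Import ring lra.
From mathcomp Require Import complex polyrcf.

(** The idea is to restrict the quadratic form of the signless Laplacian Q of
    the total graph to the vectors that take one value x on the vertices of G
    and one value y on its edges.  Two countings, of incident pairs
    (vertex, edge) and of intersecting pairs of edges, give the form on this
    plane: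
      v Q v^T = 6 m x^2 + 4 m x y + (2 Z - 2 m) y^2,  v v^T = n x^2 + m y^2,
    where Z is the Zagreb index ([two_level_form], [two_level_norm]).

    Q is symmetric, so v Q v^T lies between (v v^T) times its smallest and
    (v v^T) times its largest eigenvalue ([rayleigh]).  In orthonormal
    coordinates the restricted form is the symmetric 2 x 2 matrix with diagonal
    entries 6 m / n and 2 Z / m - 2 and off-diagonal entry c, c^2 = 4 m / n.
    Its two eigenvalues lie in the spectral interval of Q, hence the spread of
    Q is at least their difference
      2 sqrt (((6 m / n - 2 Z / m + 2) / 2)^2 + 4 m / n),
    and expanding the square gives the bound.  [compression_gap] proves this
    comparison of spreads from discriminants, without naming the eigenvalues
    of the 2 x 2 matrix. *)

Set Implicit Arguments.
Unset Strict Implicit.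
Unset Printing Implicit Defensive.
Import Order.TTheory GRing.Theory Num.Theory.
Local Open Scope ring_scope.

(** * Rayleigh bounds for real symmetric matrices *)

Definition qform (R : pzRingType) n (A : 'M[R]_n) (v : 'rV[R]_n) : R :=
  (v *m A *m v^T) 0 0.

Section SymmetricMatrices.
Local Open Scope complex_scope.
Local Open Scope sesquilinear_scope.

(** The spectral theorem over the complex numbers diagonalizes A by a unitary
    matrix P.  The eigenvalues d i are real, and the c i are the squared moduli
    of the coordinates of v in the rows of P, so that real data suffice to state
    the outcome.  Since [qform 1%:M v] is the squared norm of v, a Rayleigh
    quotient is thus a weighted mean of eigenvalues. *)
Lemma qform_spectral (R : rcfType) n (A : 'M[R]_n) (v : 'rV[R]_n) :
  A^T = A ->
  exists d c : 'I_n -> R,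
    [/\ forall i, eigenvalue A (d i), forall i, 0 <= c i,
        qform A v = \sum_i d i * c i & qform 1%:M v = \sum_i c i].
Proof.
move=> symA; pose f := real_complex R; pose Ac := map_mx f A.
have hermA : Ac \is hermsymmx.
  apply: realsym_hermsym.
    by apply/is_hermitianmxP; apply/matrixP => i j; rewrite expr0 scale1r !mxE -[in LHS]symA mxE.
  by apply/mxOverP => i j; rewrite mxE; apply/complex_realP; exists (A i j).
have /hermitian_normalmx/orthomx_spectralP/= := hermA.
have /mxOverP := hermitian_spectral_diag_real hermA.
have := spectral_unitarymx Ac.
move: (spectralmx Ac) (spectral_diag Ac) => P D uP realD AE.
have uPi := unitarymx_unit uP.
have [d dE] : exists d : 'I_n -> R, forall i, D 0 i = (d i)%:C.
  by exists (fun i => complex.Re (D 0 i)) => i; rewrite RRe_real.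
pose vc := map_mx f v.
have [w wdef] : exists w, vc *m P^t* = w by eexists.
have wE : w^t* = P *m vc^T.
  rewrite -wdef trmx_mul map_mxM trmxCK; congr (_ *m _).
  by rewrite /vc; apply/matrixP=> i j; rewrite !mxE; exact: conjc_real.
exists d, (fun i => complex.Re (w 0 i) ^+ 2 + complex.Im (w 0 i) ^+ 2); split.
- (* The i-th row of P is an eigenvector for D 0 i. *)
  move=> i; suff: eigenvalue Ac (D 0 i) by rewrite dE eigenvalue_map.
  apply/eigenvalueP; exists (row i P).
    rewrite -row_mul -/Ac AE !mulmxA mulmxV // mul1mx.
    by apply/rowP => j; rewrite mul_diag_mx !mxE.
  apply/eqP => /(congr1 (fun r => r *m invmx P)).
  rewrite -row_mul mulmxV // mul0mx => /rowP/(_ i); rewrite !mxE eqxx.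
  by apply/eqP; rewrite oner_eq0.
- by move=> i; rewrite addr_ge0 ?sqr_ge0.
- apply: (@complexI R).
  transitivity ((vc *m Ac *m vc^T) 0 0).
    by rewrite /qform /vc /Ac map_trmx -!map_mxM [RHS]mxE.
  rewrite AE invmx_unitary // !mulmxA wdef -!mulmxA -wE.
  rewrite mxE rmorph_sum /=; apply: eq_bigr => i _.
  by rewrite mul_diag_mx !mxE dE rmorphM /= add_Re2_Im2 normCK /= mulrCA.
- apply: (@complexI R).
  transitivity ((vc *m vc^T) 0 0).
    by rewrite /qform /vc mulmx1 map_trmx -!map_mxM [RHS]mxE.
  rewrite -[X in X *m _](mulmxKtV vc uP) // wdef -mulmxA -wE.
  rewrite mxE rmorph_sum /=; apply: eq_bigr => i _.
  by rewrite !mxE add_Re2_Im2 normCK.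
Qed.

End SymmetricMatrices.

(** The extreme eigenvalues are a supremum and an infimum, which bound the
    eigenvalues only if these form a bounded set; here they do, as roots of the
    characteristic polynomial. *)
Lemma eigenvalue_bounded (R : realType) n (A : 'M[R]_n) a :
  eigenvalue A a -> `|a| <= cauchy_bound (char_poly A).
Proof.
rewrite eigenvalue_root_char => /rootP r0; apply: ltW; apply: cauchy_boundP => //.
exact/monic_neq0/char_poly_monic.
Qed.

Lemma rayleigh (R : realType) n (A : 'M[R]_n) (v : 'rV[R]_n) : A^T = A ->
  smallest_eigenvalue A * qform 1%:M v <= qform A v
    <= largest_eigenvalue A * qform 1%:M v.
Proof.
move=> symA; have [d [c [dA c_ge0 -> ->]]] := qform_spectral v symA.
rewrite !mulr_sumr; apply/andP; split; apply: ler_sum => i _;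
  apply: ler_wpM2r => //.
- apply: ge_inf; last exact: dA.
  exists (- cauchy_bound (char_poly A)) => b /= /eigenvalue_bounded.
  by rewrite ler_norml => /andP[].
- apply: ub_le_sup; last exact: dA.
  exists (cauchy_bound (char_poly A)) => b /= /eigenvalue_bounded.
  by rewrite ler_norml => /andP[].
Qed.
(** * Degree sums in the line graph and in the total graph *)

Section EdgeCounting.
Variable G : sgraph.
Local Open Scope nat_scope.
Implicit Types (x y : G) (a b : edge G).

Lemma sum_indicator (T : finType) (P : pred T) : \sum_i P i = #|[set i | P i]|.
Proof. by rewrite cardsE -sum1_card [RHS]big_mkcond. Qed.

Lemma degree_sum (H : sgraph) (x : H) : degree x = \sum_y adj x y.
Proof. by rewrite sum_indicator. Qed.

Lemma edgeP a : exists x y, adj x y /\ val a = [set x; y].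
Proof. have : val a \in edges G := valP a.
by rewrite /edges => /finset.imsetP[[x y]]; rewrite inE => xy aE; exists x, y.
Qed.

Lemma edge_of_adj x y : adj x y -> exists a : edge G, val a = [set x; y].
Proof.
move=> xy; have e_edge : [set x; y] \in edges G.
  by apply/finset.imsetP; exists (x, y); rewrite ?inE.
by exists (exist (fun e : {set G} => e \in edges G) _ e_edge).
Qed.

Lemma adj_neq x y : adj x y -> x != y.
Proof. by apply: contraTneq => ->; rewrite adj_irr. Qed.

Lemma card_edge a : #|val a| = 2.
Proof. by have [x [y [/adj_neq xy ->]]] := edgeP a; rewrite cards2 xy. Qed.

(** Sending a neighbour y of x to the edge [set x; y] is a bijection onto the
    edges through x. *)
Lemma degree_incidence x : \sum_(a : edge G) (x \in val a) = degree x.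
Proof.
rewrite sum_indicator /degree.
rewrite -(card_imset _ val_inj).
have -> : [set val a | a in [set a : edge G | x \in val a]]
  = [set [set x; y] | y in [set y | adj x y]].
  apply/finset.setP => e; apply/imsetP/imsetP.
    move=> [a xa ->]; rewrite inE in xa; have [u [v [uv aE]]] := edgeP a.
    move: xa; rewrite aE !inE => /orP[] /eqP ->; first by exists v; rewrite ?inE.
    by exists u; rewrite ?inE 1?adj_sym // finset.setUC.
  move=> [y xy ->]; rewrite inE in xy.
  by have [a aE] := edge_of_adj xy; exists a; rewrite ?inE aE ?finset.set21.
apply: card_in_imset => y z; rewrite inE => /adj_neq xy _ /finset.setP/(_ y).
by rewrite !inE eqxx orbT eq_sym (negPf xy) /= => /esym/eqP.
Qed.

(** Two edges of a simple graph that share both endpoints are equal, so being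
    adjacent in the line graph amounts to a count of common endpoints. *)
Lemma card_edgeI a b : a != b -> #|val a :&: val b| = (val a :&: val b != finset.set0).
Proof.
move=> ab; rewrite -card_gt0; case kE: #|_| => [|[|k]] //.
have aI : val a :&: val b = val a.
  by apply/eqP; rewrite eqEcard finset.subsetIl card_edge kE.
have bI : val a :&: val b = val b.
  by apply/eqP; rewrite eqEcard finset.subsetIr card_edge kE.
by case/eqP: ab; apply: val_inj; rewrite -aI {1}bI.
Qed.

(** The sum on the right counts the pairs (x, b) with x in both a and b: every
    edge adjacent to a contributes once, and a itself contributes the 2. *)
Lemma line_degree a :
  @degree (line_graph G) a + 2 = \sum_(x in val a) degree x.
Proof.
under eq_bigr do rewrite -degree_incidence.
rewrite exchange_big /= (bigD1 a) //= addnC degree_sum (bigD1 a) //=.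
rewrite {1}/line_adj eqxx add0n; congr (_ + _).
  by rewrite -(card_edge a) -sum1_card; apply: eq_bigr => x ->.
apply: eq_bigr => b ba; rewrite /line_adj eq_sym ba -card_edgeI 1?eq_sym //.
rewrite -sum1_card; rewrite (eq_bigl _ _ (fun x => finset.in_setI x (val a) (val b))).
by rewrite big_mkcondr.
Qed.

Lemma card_edgeT : #|edge G| = #|edges G|.
Proof. by rewrite card_sub. Qed.

Lemma handshake : \sum_(x : G) degree x = 2 * #|edges G|.
Proof.
under eq_bigr do rewrite -degree_incidence.
rewrite exchange_big /=; under eq_bigr => a _.
  rewrite sum_indicator cardsE card_edge; over.
by rewrite sum_nat_const mulnC card_edgeT.
Qed.

(** In the sum of [line_degree] over all edges a, each vertex x contributes its
    degree once for every edge through x, that is, its degree squared. *)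
Lemma line_handshake :
  \sum_(a : edge G) @degree (line_graph G) a + 2 * #|edges G| = zagreb G.
Proof.
rewrite mulnC -card_edgeT -sum_nat_const -big_split /=.
under eq_bigr do rewrite line_degree big_mkcond.
rewrite exchange_big; apply: eq_bigr => x _.
rewrite -mulnn -[X in X * _]degree_incidence big_distrl /=.
by apply: eq_bigr => a _; case: (x \in val a); rewrite ?mul1n.
Qed.

Lemma total_degree_vertex x : @degree (total_graph G) (inl x) = 2 * degree x.
Proof.
by rewrite degree_sum big_sumType /= -degree_sum degree_incidence mul2n addnn.
Qed.

Lemma total_degree_edge a :
  @degree (total_graph G) (inr a) = 2 + @degree (line_graph G) a.
Proof.
rewrite degree_sum big_sumType /= -[X in _ + X](@degree_sum (line_graph G)).
by rewrite sum_indicator cardsE card_edge.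
Qed.

End EdgeCounting.
(** * Spread of a form compressed to a plane *)

Lemma form_ge0_disc (R : realFieldType) (a b c : R) :
  (forall x y, 0 <= a * x ^+ 2 + 2 * b * x * y + c * y ^+ 2) ->
  [/\ 0 <= a, 0 <= c & b ^+ 2 <= a * c].
Proof.
move=> form_ge0; have a_ge0 : 0 <= a by have := form_ge0 1 0; lra.
have c_ge0 : 0 <= c by have := form_ge0 0 1; lra.
split=> //; move: a_ge0; rewrite le_eqVlt => /predU1P[a0|a_gt0].
- rewrite -a0 mul0r real_leNgt ?num_real //; apply/negP => b2_gt0.
  have b_neq0 : b != 0 by apply: contraTneq b2_gt0 => ->; rewrite expr0n ltxx.
  (* For a = 0 the form is affine in x at y = 1; here it takes the value -1. *)
  have := form_ge0 (- (c + 1) / (2 * b)) 1.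
  have -> : a * (- (c + 1) / (2 * b)) ^+ 2
     + 2 * b * (- (c + 1) / (2 * b)) * 1 + c * 1 ^+ 2 = -1.
    by rewrite -a0; field.
  by lra.
- have := form_ge0 (- b) a.
  have -> : a * (- b) ^+ 2 + 2 * b * - b * a + c * a ^+ 2 = a * (a * c - b ^+ 2).
    by ring.
  by rewrite pmulr_rge0 // subr_ge0.
Qed.

(** The square root on the left is half the distance between the eigenvalues of
    the 2 x 2 matrix with diagonal entries a / n, c / m and off-diagonal entry
    b / sqrt (n m).  With p, q the distances from L to the diagonal entries,
    nonnegativity of the gap to L reads b^2 / (n m) <= p q, so that
      (p - q)^2 + 4 b^2 / (n m) <= (p + q)^2.
    The distances r, s from l to the diagonal entries satisfy the same, with
    the same square on the left, and the claim is the average of both bounds,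
    as p + r = q + s = L - l. *)
Lemma compression_gap (R : rcfType) (l L n m a b c : R) : 0 < n -> 0 < m ->
  (forall x y, l * (n * x ^+ 2 + m * y ^+ 2)
     <= a * x ^+ 2 + 2 * b * x * y + c * y ^+ 2
     <= L * (n * x ^+ 2 + m * y ^+ 2)) ->
  2 * Num.sqrt (((a / n - c / m) / 2) ^+ 2 + b ^+ 2 / (n * m)) <= L - l.
Proof.
move=> n_gt0 m_gt0 form_le; set X := _ + _.
have [nz mz] : n != 0 /\ m != 0 by rewrite !gt_eqF.
have sqrtX_le p q : 0 <= p -> 0 <= q -> b ^+ 2 <= (n * p) * (m * q) ->
    (p - q) ^+ 2 = (a / n - c / m) ^+ 2 -> 2 * Num.sqrt X <= p + q.
  move=> p_ge0 q_ge0 b2_le pqE.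
  have b2_le' : b ^+ 2 / (n * m) <= p * q.
    rewrite ler_pdivrMr ?mulr_gt0 //; apply: le_trans b2_le _.
    by rewrite le_eqVlt; apply/orP; left; apply/eqP; ring.
  rewrite mulrC -ler_pdivlMr // -[leRHS]ger0_norm ?divr_ge0 ?addr_ge0 //.
  by rewrite -sqrtr_sqr ler_wsqrtr // /X expr_div_n -pqE; lra.
have [] := @form_ge0_disc _ (L * n - a) (- b) (L * m - c).
  by move=> x y; have /andP[_] := form_le x y; lra.
have LaE : L * n - a = n * (L - a / n) by field.
have LcE : L * m - c = m * (L - c / m) by field.
rewrite {}LaE {}LcE sqrrN !pmulr_rge0 // => La Lc discL.
have [] := @form_ge0_disc _ (a - l * n) b (c - l * m).
  by move=> x y; have /andP[+ _] := form_le x y; lra.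
have laE : a - l * n = n * (a / n - l) by field.
have lcE : c - l * m = m * (c / m - l) by field.
rewrite {}laE {}lcE !pmulr_rge0 // => la lc discl.
have := sqrtX_le _ _ La Lc discL; have := sqrtX_le _ _ la lc discl.
have -> : (a / n - l - (c / m - l)) ^+ 2 = (a / n - c / m) ^+ 2 by ring.
have -> : (L - a / n - (L - c / m)) ^+ 2 = (a / n - c / m) ^+ 2 by ring.
by move=> /(_ erefl) ? /(_ erefl) ?; lra.
Qed.

(** * The signless Laplacian form on two-level vectors *)

Lemma signless_sym (R : realType) (H : sgraph) :
  (signless_laplacian R H)^T = signless_laplacian R H.
Proof.
rewrite /signless_laplacian linearD /= tr_diag_mx; congr (_ + _).
by apply/matrixP => i j; rewrite !mxE adj_sym.
Qed.

Definition vertex_vec (R : realType) (H : sgraph) (f : H -> R) : 'rV[R]_#|H| :=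
  \row_i f (enum_val i).

Lemma qform_one (R : realType) (H : sgraph) (f : H -> R) :
  qform 1%:M (vertex_vec f) = \sum_x f x ^+ 2.
Proof.
rewrite /qform mulmx1 mxE (big_enum_val (fun x => f x ^+ 2)).
by apply: eq_bigr => i _; rewrite !mxE expr2.
Qed.

Lemma qform_signless (R : realType) (H : sgraph) (f : H -> R) :
  qform (signless_laplacian R H) (vertex_vec f) =
    \sum_x (degree x)%:R * f x ^+ 2 +
    \sum_x \sum_y (adj x y)%:R * (f x * f y).
Proof.
rewrite /qform mulmxDr mulmxDl mxE; congr (_ + _).
  rewrite mul_mx_diag mxE (big_enum_val (fun x => (degree x)%:R * f x ^+ 2)).
  by apply: eq_bigr => i _; rewrite !mxE; ring.
rewrite -mulmxA mxE.
rewrite (big_enum_val (fun x => \sum_y (adj x y)%:R * (f x * f y))).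
apply: eq_bigr => i _; rewrite !mxE mulr_sumr.
rewrite (big_enum_val (fun y => (adj (enum_val i) y)%:R * _)).
by apply: eq_bigr => j _; rewrite !mxE; ring.
Qed.

Section TotalGraphForm.
Variables (R : realType) (G : sgraph).
Local Notation n := (#|G|%:R : R).
Local Notation m := (#|edges G|%:R : R).
Local Notation Z := ((zagreb G)%:R : R).

Lemma sum_total (F : total_graph G -> R) :
  \sum_u F u = \sum_(x : G) F (inl x) + \sum_(a : edge G) F (inr a).
Proof. exact: (@big_sumType _ _ _ G (edge G) xpredT F). Qed.

Definition two_level (x y : R) (u : total_graph G) : R :=
  if u is inl _ then x else y.

Lemma two_level_norm x y :
  \sum_u two_level x y u ^+ 2 = n * x ^+ 2 + m * y ^+ 2.
Proof.
by rewrite sum_total /= !sumr_const card_edgeT -(mulr_natl (x ^+ 2))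
  -(mulr_natl (y ^+ 2)).
Qed.

(** The coefficient 6 m of x^2 is the sum of the degrees 2 d(v) of the vertices
    v in the total graph plus the 2 m ordered adjacent pairs; for y^2 the two
    contributions are Z and Z - 2 m, and each of the 2 m incidences counts
    twice in x y. *)
Lemma two_level_form x y :
  qform (signless_laplacian R (total_graph G)) (vertex_vec (two_level x y)) =
  6 * m * x ^+ 2 + 2 * (2 * m) * x * y + (2 * Z - 2 * m) * y ^+ 2.
Proof.
have handR : \sum_(v : G) (degree v)%:R = 2 * m by rewrite -natr_sum handshake natrM.
have lineR : \sum_(a : edge G) (@degree (line_graph G) a)%:R = Z - 2 * m.
  by rewrite -natr_sum -line_handshake natrD natrM addrK.
have vv (v : G) : \sum_w (adj v w)%:R = (degree v)%:R :> R.
  by rewrite -natr_sum -degree_sum.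
have ve (v : G) : \sum_(a : edge G) (v \in val a)%:R = (degree v)%:R :> R.
  by rewrite -natr_sum degree_incidence.
have ee (a : edge G) :
    \sum_b (line_adj a b)%:R = (@degree (line_graph G) a)%:R :> R.
  by rewrite -natr_sum -(@degree_sum (line_graph G)).
rewrite qform_signless !sum_total /=.
under eq_bigr do rewrite total_degree_vertex natrM.
under [\sum_(a : edge G) (degree _)%:R * _]eq_bigr do
  rewrite total_degree_edge natrD.
under [X in _ + (X + _)]eq_bigr do
  rewrite sum_total /= -!mulr_suml vv ve.
under [X in _ + (_ + X)]eq_bigr do rewrite sum_total /= -!mulr_suml ee.
rewrite !big_split /= -!mulr_suml -mulr_sumr exchange_big /=.
rewrite (eq_bigr _ (fun v _ => ve v)) big_split /= sumr_const card_edgeT.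
by rewrite handR lineR -(mulr_natl 2); ring.
Qed.

End TotalGraphForm.

Lemma edge_card_gt0 (G : sgraph) : (0 < #|edges G|)%N -> (0 < #|G|)%N.
Proof.
move=> /card_gt0P[e e_edge]; have [x _] := edgeP (exist _ e e_edge : edge G).
by apply/card_gt0P; exists x.
Qed.

(** * The spread of the total graph *)

Theorem theorem24 (R : realType) (G : sgraph) (n m : nat)
    (hn : #|G| = n) (hm : #|edges G| = m)
    (m_ge1 : (1 <= m)%N) (Gconn : connected_graph G) :
  signless_spread R (total_graph G) >=
    2 * Num.sqrt ((3 * m%:R / n%:R - (zagreb G)%:R / m%:R) ^+ 2
                  + 10 * m%:R / n%:R - 2 * (zagreb G)%:R / m%:R + 1).
Proof.
have mR_gt0 : 0 < m%:R :> R by rewrite ltr0n.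
have nR_gt0 : 0 < n%:R :> R by rewrite ltr0n -hn edge_card_gt0 ?hm.
have [nz mz] : n%:R != 0 :> R /\ m%:R != 0 :> R by rewrite !gt_eqF.
pose Q := signless_laplacian R (total_graph G).
have := @compression_gap R (smallest_eigenvalue Q) (largest_eigenvalue Q)
  n%:R m%:R (6 * m%:R) (2 * m%:R) (2 * (zagreb G)%:R - 2 * m%:R)
  nR_gt0 mR_gt0.
rewrite /signless_spread -/Q.
suff <- : ((6 * m%:R / n%:R - (2 * (zagreb G)%:R - 2 * m%:R) / m%:R) / 2) ^+ 2
    + (2 * m%:R) ^+ 2 / (n%:R * m%:R)
  = (3 * m%:R / n%:R - (zagreb G)%:R / m%:R) ^+ 2
    + 10 * m%:R / n%:R - 2 * (zagreb G)%:R / m%:R + 1 :> R.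
  apply=> x y.
  have := rayleigh (vertex_vec (two_level x y))
    (signless_sym R (total_graph G)).
  by rewrite two_level_form qform_one two_level_norm hn hm.
by field; rewrite nz mz.
Qed.
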